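(* Consider the distributed matrix multiplication problem of computing $C=A^{\intercal}B$, with $A\in\mathbb{F}^{s\times r}$ and $B\in\mathbb{F}^{s\times t}$, using $N$ workers, with parameters $p,m,n$. Define $$K_{\textup{entangled-poly}}\triangleq\begin{cases}pmn+p-1,& N\ge pmn+p-1,\\ N,& N<pmn+p-1.\end{cases}$$ Then the recovery threshold $K_{\textup{entangled-poly}}$ is achieved by a linear code, i.e. there exists a linear code $(\boldsymbol f,\boldsymbol g,\boldsymbol d)$ with recovery threshold $K(\boldsymbol f,\boldsymbol g,\boldsymbol d)=K_{\textup{entangled-poly}}$.
   Context: Setting. $p,m,n,N,s,r,t$ are positive integers with $p\mid s$, $m\mid r$, $n\mid t$, and $\mathbb{F}$ is a (finite or infinite) field that is sufficiently large, i.e. $|\mathbb F|\ge q_0$ for some threshold $q_0$ depending only on $p,m,n,N$. There are $N$ workers, indexed $0,\dots,N-1$. A computation strategy consists of encoding functions $\boldsymbol f=(f_0,\dots,f_{N-1})$, $f_i:\mathbb F^{s\times r}\to\mathbb F^{\frac sp\times\frac rm}$, and $\boldsymbol g=(g_0,\dots,g_{N-1})$, $g_i:\mathbb F^{s\times t}\to\mathbb F^{\frac sp\times\frac tn}$, together with decoding functions $\boldsymbol d=\{d_{\mathcal K}\}_{\mathcal K\subseteq\{0,\dots,N-1\}}$. Worker $i$ stores $\tilde A_i=f_i(A)$ and $\tilde B_i=g_i(B)$ and returns $\tilde C_i=\tilde A_i^{\intercal}\tilde B_i$; from the results of a subset $\mathcal K$ of workers the master computes the estimate $\hat C=d_{\mathcal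 K}(\{\tilde C_i\}_{i\in\mathcal K})$. The strategy is $k$-recoverable if for every subset $\mathcal K$ of exactly $k$ workers, $\hat C=A^{\intercal}B$ for all inputs $A,B$. The recovery threshold $K(\boldsymbol f,\boldsymbol g,\boldsymbol d)$ is the minimum integer $k$ such that the strategy is $k$-recoverable. Linear code. Partition $A$ into $p\times m$ equal-size blocks $A_{j,k}\in\mathbb F^{\frac sp\times\frac rm}$ and $B$ into $p\times n$ equal-size blocks $B_{j,k}\in\mathbb F^{\frac sp\times\frac tn}$. A computation strategy is a linear code if there are scalars $a_{ijk},b_{ijk}\in\mathbb F$ with $\tilde A_i=\sum_{j,k}A_{j,k}a_{ijk}$ and $\tilde B_i=\sum_{j,k}B_{j,k}b_{ijk}$ for each worker $i$, and for each $\mathcal K$ there are scalars $c_{ijk}\in\mathbb F$ (which may depend on $\mathcal K$) such that the decoded estimate of the block $C_{j,k}=\sum_{\ell}A_{\ell,j}^{\intercal}B_{\ell,k}$ is $\hat C_{j,k}=\sum_{i\in\mathcal K}\tilde C_i c_{ijk}$. Standing assumption: $N$ is large enough that at least one linear code that is $N$-recoverable exists. *)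

(* Defs.v *)
From mathcomp Require Import all_boot all_order all_algebra.
Set Implicit Arguments.
Unset Strict Implicit.
Unset Printing Implicit Defensive.
Import GRing.Theory.
Local Open Scope ring_scope.

Definition card_ge (T : eqType) (q : nat) : Prop :=
  exists l : seq T, uniq l /\ (q <= size l)%N.

Lemma block_lt (p s : nat) (dp : (p %| s)%N) (j : 'I_p) (u : 'I_(s %/ p)) :
  (j * (s %/ p) + u < s)%N.
Proof.
have Hs : (j.+1 * (s %/ p) <= s)%N.
  by rewrite -[leqRHS](divnK dp) mulnC leq_mul2l ltn_ord orbT.
by apply: leq_trans Hs; rewrite mulSn addnC ltn_add2r.
Qed.

Definition block_ord (p s : nat) (dp : (p %| s)%N)
    (j : 'I_p) (u : 'I_(s %/ p)) : 'I_s :=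
  Ordinal (block_lt dp j u).

(* The (j, k) block of M cut into a p x m grid of contiguous blocks of equal
   size. *)
Definition block (F : fieldType) (p m s r : nat)
    (dp : (p %| s)%N) (dm : (m %| r)%N) (M : 'M[F]_(s, r))
    (j : 'I_p) (k : 'I_m) : 'M[F]_(s %/ p, r %/ m) :=
  \matrix_(u, v) M (block_ord dp j u) (block_ord dm k v).

(* The decoder for the set K only sees the results of the workers in K. *)
Record strategy (F : fieldType) (N p m n s r t : nat) : Type := Strategy {
  encA : 'I_N -> 'M[F]_(s, r) -> 'M[F]_(s %/ p, r %/ m);
  encB : 'I_N -> 'M[F]_(s, t) -> 'M[F]_(s %/ p, t %/ n);
  dec : forall K : {set 'I_N},
    {ffun {i : 'I_N | i \in K} -> 'M[F]_(r %/ m, t %/ n)} -> 'M[F]_(r, t)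
}.

Section Strategy.
Context (F : fieldType) (N p m n s r t : nat).
Implicit Type S : strategy F N p m n s r t.

Definition worker_result S (A : 'M[F]_(s, r)) (B : 'M[F]_(s, t)) (i : 'I_N) :
    'M[F]_(r %/ m, t %/ n) :=
  (encA S i A)^T *m encB S i B.

Definition estimate S (K : {set 'I_N}) (A : 'M[F]_(s, r)) (B : 'M[F]_(s, t)) :
    'M[F]_(r, t) :=
  dec S (K := K) [ffun i => worker_result S A B (val i)].

Definition recoverable S (k : nat) : Prop :=
  forall K : {set 'I_N}, #|K| = k ->
  forall (A : 'M[F]_(s, r)) (B : 'M[F]_(s, t)), estimate S K A B = A^T *m B.

(* recoverable S k holds vacuously for N < k, so a strategy that is recoverable
   for no k <= N gets threshold N.+1. *)
Definition recovery_threshold S (k : nat) : Prop :=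
  recoverable S k /\ forall k' : nat, recoverable S k' -> (k <= k')%N.

Definition linear_code (dp : (p %| s)%N) (dm : (m %| r)%N) (dn : (n %| t)%N) S :
    Prop :=
  [/\ exists a : 'I_N -> 'I_p -> 'I_m -> F, forall i A,
        encA S i A = \sum_(j < p) \sum_(k < m) a i j k *: block dp dm A j k,
      exists b : 'I_N -> 'I_p -> 'I_n -> F, forall i B,
        encB S i B = \sum_(j < p) \sum_(k < n) b i j k *: block dp dn B j k
    & forall K : {set 'I_N},
        exists c : {i : 'I_N | i \in K} -> 'I_m -> 'I_n -> F, forall y j k,
        block dm dn (dec S (K := K) y) j k = \sum_i c i j k *: y i].

End Strategy.

Definition K_entangled_poly (p m n N : nat) : nat :=
  if (p * m * n + p - 1 <= N)%N then (p * m * n + p - 1)%N else N.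

(* Main.v *)
(** Entangled polynomial codes: with [N] distinct evaluation points [x_i], the
    workers store
      [sum_(j,k) x_i^(j + k p) A_{j,k}]  and
      [sum_(j,k) x_i^(p-1-j + k p m) B_{j,k}].
    The products are values of a matrix polynomial of degree less than
    [pmn+p-1], and [C_{j,k}] is exactly its coefficient of degree
    [p-1 + j p + k p m], because the exponent of [A_{j1,k1}^T B_{j2,k2}] takes
    that value only for [j1 = j2], [k1 = j], [k2 = k]. So [pmn+p-1] products
    determine [C] by inverting a Vandermonde matrix. When [N < pmn+p-1] the
    assumed [N]-recoverable code is used instead. Decoders being part of the
    strategy, replacing those of smaller worker sets by zero makes the threshold
    exact. *)
Require Import Defs.
From mathcomp Require Import all_boot all_algebra.
From mathcomp Require Import zify.
Set Implicit Arguments.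
Unset Strict Implicit.
Unset Printing Implicit Defensive.
Import GRing.Theory.

Lemma euclid_uniq (d q1 q2 r1 r2 : nat) : r1 < d -> r2 < d ->
  q1 * d + r1 = q2 * d + r2 -> r1 = r2 /\ q1 = q2.
Proof.
move=> h1 h2 e; have d0 : 0 < d by apply: leq_trans h1.
split; first by have := congr1 (modn^~ d) e; rewrite /= !modnMDl !modn_small.
by have := congr1 (divn^~ d) e; rewrite /= !divnMDl // !divn_small // !addn0.
Qed.

Section Blocks.
Context (p s : nat) (dp : p %| s).

Lemma block_ord_bij :
  bijective (fun q : 'I_p * 'I_(s %/ p) => block_ord dp q.1 q.2).
Proof.
apply: inj_card_bij; last by rewrite card_prod !card_ord mulnC divnK.
move=> [j u] [j' u'] /(congr1 val) /=.
by case/euclid_uniq=> // /val_inj -> /val_inj ->.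
Qed.

End Blocks.

Local Open Scope ring_scope.

Section BlockMatrix.
Context (F : fieldType) (m n r t : nat) (dm : (m %| r)%N) (dn : (n %| t)%N).

(** Lets a decoder be specified block by block: [asm] glues prescribed blocks into one matrix. *)
Lemma block_surj :
  exists asm : ('I_m -> 'I_n -> 'M[F]_(r %/ m, t %/ n)) -> 'M[F]_(r, t),
  forall X j k, block dm dn (asm X) j k = X j k.
Proof.
have [[f fK _] [g gK _]] := (block_ord_bij dm, block_ord_bij dn).
exists (fun X => \matrix_(a, b) X (f a).1 (g b).1 (f a).2 (g b).2) => X j k.
apply/matrixP=> u v; rewrite !mxE.
by rewrite (fK (j, u)) (gK (k, v)).
Qed.

Lemma block_inj (M M' : 'M[F]_(r, t)) :
  (forall j k, block dm dn M j k = block dm dn M' j k) -> M = M'.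
Proof.
have [[f _ fK] [g _ gK]] := (block_ord_bij dm, block_ord_bij dn).
move=> e; apply/matrixP=> a b; rewrite -(fK a) -(gK b).
by have /matrixP/(_ (f a).2 (g b).2) := e (f a).1 (g b).1; rewrite !mxE.
Qed.

Lemma block_trmx_mul (p s : nat) (dp : (p %| s)%N)
    (A : 'M[F]_(s, r)) (B : 'M[F]_(s, t)) j k :
  block dm dn (A^T *m B) j k =
  \sum_(l < p) (block dp dm A l j)^T *m block dp dn B l k.
Proof.
apply/matrixP=> u v; rewrite summxE !mxE.
rewrite (reindex _ (onW_bij _ (block_ord_bij dp))) /=.
rewrite -(pair_bigA _ (fun l w => A^T (block_ord dm j u) (block_ord dp l w)
   * B (block_ord dp l w) (block_ord dn k v))) /=.
apply: eq_bigr => l _; rewrite mxE; apply: eq_bigr => w _.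
by rewrite !mxE.
Qed.

End BlockMatrix.

Lemma trmx_mul_neq0 (F : fieldType) (s r t : nat) :
  (0 < s)%N -> (0 < r)%N -> (0 < t)%N ->
  exists (A : 'M[F]_(s, r)) (B : 'M[F]_(s, t)), A^T *m B != 0.
Proof.
case: s r t => // s [] // r [] // t _ _ _.
exists (delta_mx 0 0), (delta_mx 0 0); rewrite trmx_delta mul_delta_mx.
by apply/eqP=> /matrixP/(_ 0 0); rewrite !mxE !eqxx; apply/eqP/oner_neq0.
Qed.

Section Threshold.
Context (F : fieldType) (N p m n s r t : nat).
Context (dp : (p %| s)%N) (dm : (m %| r)%N) (dn : (n %| t)%N).

(** The code is kept, except that sets of fewer than [k] workers decode to zero. This is still
    linear, and it fails on any inputs with a nonzero product. *)
Lemma recovery_threshold_exact (S : strategy F N p m n s r t) (k : nat) :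
  (0 < s)%N -> (0 < r)%N -> (0 < t)%N -> (k <= N)%N ->
  linear_code dp dm dn S -> recoverable S k ->
  exists S' : strategy F N p m n s r t,
    linear_code dp dm dn S' /\ recovery_threshold S' k.
Proof.
move=> s0 r0 t0 kN [linA linB linD] recS.
exists (Strategy (encA S) (encB S)
  (fun K y => if (#|K| < k)%N then 0 else dec S (K := K) y)).
split; first split=> //= K.
  have [_|_] := ltnP #|K| k; last exact: linD.
  exists (fun _ _ _ => 0) => y j l.
  rewrite big1 => [|i _]; last by rewrite scale0r.
  by apply/matrixP=> u v; rewrite !mxE.
split=> [K Kk A B|k' rec']; first by rewrite /estimate /= Kk ltnn; exact: recS.
rewrite leqNgt; apply/negP=> lt_k'k.
(* Since [k' < k <= N], a set of exactly [k'] workers exists, so [rec'] is not vacuous. *)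
pose K := [set i : 'I_N | (i < k')%N].
have Kk' : #|K| = k'.
  have le_k'N : (k' <= N)%N by apply: leq_trans kN; apply: ltnW.
  have w_inj : injective (widen_ord le_k'N).
    by move=> i i' /(congr1 val) /= /val_inj.
  rewrite -[RHS]card_ord -(card_imset _ w_inj).
  apply: eq_card => i; rewrite inE; apply/idP/imsetP => [lt_i|[j _ ->] //=].
  by exists (Ordinal lt_i) => //; apply: val_inj.
have [A [B /eqP[]]] := trmx_mul_neq0 F s0 r0 t0.
by rewrite -(rec' K Kk') /estimate /= Kk' lt_k'k.
Qed.

End Threshold.

(** The weights [c d] are a column of the inverse Vandermonde matrix: they extract the coefficient
    of degree [d] of a polynomial of degree less than [#|I|] from its values at the points [x i]. *)
Lemma coef_of_values (F : fieldType) (I : finType) (x : I -> F) :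
  injective x ->
  exists c : nat -> I -> F, forall d e, (d < #|I|)%N -> (e < #|I|)%N ->
    \sum_i c d i * x i ^+ e = (e == d)%:R.
Proof.
move=> x_inj; pose V := Vandermonde #|I| (\row_(h < #|I|) x (enum_val h)).
have V_unit : V \in unitmx.
  rewrite unitmxE det_Vandermonde unitfE.
  apply/prodf_neq0 => i _; apply/prodf_neq0 => j lt_ij.
  rewrite !mxE subr_eq0 (inj_eq x_inj) (inj_eq enum_val_inj).
  by rewrite neq_ltn lt_ij orbT.
(* Degrees are plain naturals, so the type of [c] does not involve [#|I|]; the default 0 is only
   reached for [d >= #|I|]. *)
exists (fun d i => if insub d is Some h then invmx V (enum_rank i) h else 0).
move=> d e dI eI; rewrite insubT.
have /matrixP/(_ (Ordinal eI) (Ordinal dI)) := mulmxV V_unit.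
rewrite !mxE => /= <-.
rewrite (reindex _ (onW_bij _ (enum_val_bij I))) /=.
by apply: eq_bigr => h _; rewrite !mxE enum_valK mulrC.
Qed.

(** Moving [j2] to the right and cancelling [p.-1] leaves two mixed-radix expansions, with lowest
    digits [j1], [j2] in base [p] and next digits [k1], [j] in base [m]; digits are unique. *)
Lemma entangled_exponent_eq (p m j1 k1 j2 k2 j k : nat) :
  (j1 < p)%N -> (j2 < p)%N -> (k1 < m)%N -> (j < m)%N ->
  ((j1 + k1 * p) + (p.-1 - j2 + k2 * (p * m)) == p.-1 + j * p + k * (p * m))%N
  = [&& j1 == j2, k1 == j & k2 == k].
Proof.
move=> h1 h2 h3 h4.
have le2 : (j2 <= p.-1)%N by rewrite -ltnS prednK //; apply: leq_trans h2.
apply/eqP/and3P => [e|[/eqP-> /eqP-> /eqP->]]; last first.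
  by rewrite addnACA subnKC // addnA.
have e' : ((k2 * m + k1) * p + j1 = (k * m + j) * p + j2)%N.
  apply/eqP; rewrite -(eqn_add2r (p.-1 - j2)) -[eqbRHS]addnA (subnKC le2).
  apply/eqP; rewrite !mulnDl -!mulnA ![(m * p)%N]mulnC.
  by move: e; lia.
have [-> e2] := euclid_uniq h1 h2 e'.
by have [-> ->] := euclid_uniq h3 h4 e2; rewrite !eqxx.
Qed.

(** The largest exponent, at [j1 = p-1], [k1 = m-1], [j2 = 0], [k2 = n-1], is [pmn+p-2]. *)
Lemma entangled_exponent_lt (p m n j1 k1 j2 k2 : nat) :
  (j1 < p)%N -> (k1 < m)%N -> (k2 < n)%N ->
  ((j1 + k1 * p) + (p.-1 - j2 + k2 * (p * m)) < p * m * n + p - 1)%N.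
Proof.
move=> h1 h3 h4.
have : (k1.+1 * p <= p * m)%N by rewrite mulnC leq_mul2l h3 orbT.
have : (k2.+1 * (p * m) <= p * m * n)%N.
  by rewrite [leqRHS]mulnC leq_mul2r h4 orbT.
rewrite !mulSn; lia.
Qed.

Lemma trmx_mul_sum2 (F : fieldType) (I J I' J' : finType) (u v w : nat)
    (a : I -> J -> F) (b : I' -> J' -> F)
    (X : I -> J -> 'M[F]_(u, v)) (Y : I' -> J' -> 'M[F]_(u, w)) :
  (\sum_i \sum_j a i j *: X i j)^T *m (\sum_i \sum_j b i j *: Y i j) =
  \sum_(q : I * J) \sum_(q' : I' * J')
    (a q.1 q.2 * b q'.1 q'.2) *: ((X q.1 q.2)^T *m Y q'.1 q'.2).
Proof.
rewrite pair_bigA [X in _ *m X]pair_bigA /= (linear_sum trmx) mulmx_suml /=.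
apply: eq_bigr => q _; rewrite mulmx_sumr; apply: eq_bigr => q' _.
by rewrite [(_ *: _)^T]linearZ /= -scalemxAl -scalemxAr scalerA.
Qed.

Section EntangledCode.
Context (F : fieldType) (N p m n s r t : nat).
Context (dp : (p %| s)%N) (dm : (m %| r)%N) (dn : (n %| t)%N).

Lemma entangled_code (x : 'I_N -> F) :
  (0 < p)%N -> injective x ->
  exists S : strategy F N p m n s r t,
    linear_code dp dm dn S /\ recoverable S (p * m * n + p - 1)%N.
Proof.
move=> p0 x_inj.
pose a i (j : 'I_p) (k : 'I_m) := x i ^+ (j + k * p).
pose b i (j : 'I_p) (k : 'I_n) := x i ^+ (p.-1 - j + k * (p * m)).
pose W (K : {set 'I_N}) := {i : 'I_N | i \in K}.
(* There are finitely many sets [K], so the weights can be chosen for all of them at once, as the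
   decoder requires. *)
have /fin_all_exists [c cP] (K : {set 'I_N}) : exists c : nat -> W K -> F,
    forall d e, (d < #|K|)%N -> (e < #|K|)%N ->
    \sum_i c d i * x (val i) ^+ e = (e == d)%:R.
  have [c cP] := coef_of_values (inj_comp x_inj (@val_inj _ _ (W K))).
  by exists c => d e dK eK; apply: cP; rewrite card_sig.
have [asm asmP] := block_surj F dm dn.
pose deg (j : 'I_m) (k : 'I_n) := (p.-1 + j * p + k * (p * m))%N.
pose S : strategy F N p m n s r t := Strategy
  (fun i A => \sum_j \sum_k a i j k *: block dp dm A j k)
  (fun i B => \sum_j \sum_k b i j k *: block dp dn B j k)
  (fun K y => asm (fun j k => \sum_i c K (deg j k) i *: y i)).
exists S; split.
  split; [by exists a | by exists b | move=> K].
  by exists (fun i j k => c K (deg j k) i) => y j k; rewrite /= asmP.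
move=> K KD A B; apply: (block_inj (dm := dm) (dn := dn)) => j k.
rewrite /estimate /= asmP (block_trmx_mul dm dn dp).
under eq_bigr => i _ do
  rewrite ffunE /worker_result /= trmx_mul_sum2 scaler_sumr.
rewrite exchange_big /=.
(* With the sum over workers innermost, the weights turn each power of [x i] into the indicator of
   degree [deg j k]. *)
transitivity (\sum_(q : 'I_p * 'I_m) \sum_(q' : 'I_p * 'I_n)
   [&& q.1 == q'.1, q.2 == j & q'.2 == k]%:R *:
   ((block dp dm A q.1 q.2)^T *m block dp dn B q'.1 q'.2)).
  apply: eq_bigr => q _.
  under eq_bigr => i _ do rewrite scaler_sumr.
  rewrite exchange_big /=; apply: eq_bigr => q' _.
  under eq_bigr => i _ do rewrite scalerA -exprD.
  rewrite -scaler_suml cP; last 2 first.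
  (* The target degree is itself the exponent for [j1 = j2 = 0], [k1 = j], [k2 = k], so the same
     bound applies. *)
  - have -> : deg j k = (0 + j * p + (p.-1 - 0 + k * (p * m)))%N.
      by rewrite /deg subn0; lia.
    by rewrite KD; apply: entangled_exponent_lt.
  - by rewrite KD; apply: entangled_exponent_lt.
  by rewrite entangled_exponent_eq.
rewrite -(pair_bigA _ (fun l k1 => \sum_(q' : 'I_p * 'I_n)
   [&& l == q'.1, k1 == j & q'.2 == k]%:R *:
   ((block dp dm A l k1)^T *m block dp dn B q'.1 q'.2))) /=.
apply: eq_bigr => l _; rewrite (bigD1 j) //= (bigD1 (l, k)) //= !eqxx scale1r.
rewrite !big1 ?addr0 // => [k1 /negPf ne|[l2 k2]].
  by rewrite big1 // => q' _; rewrite ne /= andbF scale0r.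
rewrite xpair_eqE eq_sym => /negPf /= ne.
by rewrite ne scale0r.
Qed.

End EntangledCode.

Local Close Scope ring_scope.

Theorem theorem1 (p m n N : nat)
    (hp : 0 < p) (hm : 0 < m) (hn : 0 < n) (hN : 0 < N) :
  exists q0 : nat,
  forall (F : fieldType), card_ge F q0 ->
  forall (s r t : nat), 0 < s -> 0 < r -> 0 < t ->
  forall (dp : p %| s) (dm : m %| r) (dn : n %| t),
  (exists S : strategy F N p m n s r t,
     linear_code dp dm dn S /\ recoverable S N) ->
  exists S : strategy F N p m n s r t,
    linear_code dp dm dn S /\ recovery_threshold S (K_entangled_poly p m n N).
Proof.
(* [N] field elements suffice: one distinct evaluation point per worker. *)
exists N => F [l [l_uniq le_Nl]] s r t s0 r0 t0 dp dm dn [S0 [lin0 rec0]].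
rewrite /K_entangled_poly; case: ifP => [le_N|_]; last first.
  exact: recovery_threshold_exact lin0 rec0.
pose x (i : 'I_N) := nth 0%R l i.
have x_inj : injective x.
  move=> i j /eqP; rewrite nth_uniq ?(leq_trans (ltn_ord _)) //.
  by move=> /eqP /val_inj.
have [S [linS recS]] := entangled_code dp dm dn hp x_inj.
exact: recovery_threshold_exact linS recS.
Qed.
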